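(* Let $n\ge 2$ and let $\mathcal{S}=(\mathcal{Q}_1\otimes\cdots\otimes\mathcal{Q}_n)^\perp$ be a co-doubly commuting submodule of $H^2(\mathbb{D}^n)$, where $\mathcal{Q}_i$ is a quotient module of $H^2(\mathbb{D})$, $i=1,\ldots,n$. Then the rank of $\mathcal{S}$ is less than or equal to the number of indices $i$ for which $\mathcal{Q}_i$ is different from $H^2(\mathbb{D})$. Moreover, equality holds if $1\in\mathcal{Q}_i$ for all $1\le i\le n$.
   Context: $H^2(\mathbb{D}^n)$ is the Hardy space over the unit polydisc, i.e. the reproducing kernel Hilbert space of holomorphic functions on $\mathbb{D}^n$ with kernel $\prod_{i=1}^n(1-z_i\bar w_i)^{-1}$, identified with the $n$-fold Hilbert space tensor product $H^2(\mathbb{D})\otimes\cdots\otimes H^2(\mathbb{D})$. $M_{z_i}$ is multiplication by $z_i$, and $M_z^{\boldsymbol{k}}=M_{z_1}^{k_1}\cdots M_{z_n}^{k_n}$ for $\boldsymbol{k}\in\mathbb{N}^n$ (with $0\in\mathbb{N}$). A closed subspace is a submodule if it is invariant under all coordinate multiplication operators; a closed subspace $\mathcal{Q}$ is a quotient module if $\mathcal{Q}^\perp$ is a submodule. A quotient module $\mathcal{Q}$ is doubly commuting if the compressions $C_{z_i}=P_{\mathcal{Q}}M_{z_i}|_{\mathcal{Q}}$ satisfy $C_{z_i}C_{z_j}^*=C_{z_j}^*C_{z_i}$ for all $1\le i<j\le n$; a submodule $\mathcal{S}$ is co-doubly commuting if $\mathcal{S}^\perp$ is doubly commuting. The rank of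 a submodule $\mathcal{S}$ is the smallest cardinality of a set $E\subseteq\mathcal{S}$ such that $\bigvee_{\boldsymbol{k}\in\mathbb{N}^n}M_z^{\boldsymbol{k}}E=\mathcal{S}$, where $\bigvee$ denotes closed linear span. *)

(* Defs.v *)
From HB Require Import structures.
From mathcomp Require Import all_boot all_order all_algebra sesquilinear.
From mathcomp Require Import all_classical all_reals all_analysis.
From mathcomp.real_closed Require Import complex.

Set Implicit Arguments.
Unset Strict Implicit.
Unset Printing Implicit Defensive.

Import Order.TTheory GRing.Theory Num.Theory numFieldNormedType.Exports.

Local Open Scope classical_set_scope.
Local Open Scope ring_scope.

(* The reproducing kernel Hilbert space on X with kernel K.  Its vectors are
   functions on X through the injective evaluation [ev]; the inner product is
   linear in its first argument.  Linearity of [ev] follows from [reproducing],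
   and K determines the space up to unitary isomorphism preserving [ev]. *)
Record rkhs (R : realType) (X : Type) (K : X -> X -> R[i]) := Rkhs {
  vec :> completeNormedModType R[i];
  dot : {dot vec for Num.conj};
  norm_dot : forall f : vec, `|f| ^+ 2 = dot f f;
  ev : vec -> X -> R[i];
  ev_inj : injective ev;
  kern : X -> vec;
  ev_kern : forall w z, ev (kern w) z = K z w;
  reproducing : forall f w, dot f (kern w) = ev f w
}.
Arguments dot {R X K r}.
Arguments ev {R X K r}.

Section Subspaces.
Context {R : realType} {X : Type} {K : X -> X -> R[i]} {H : rkhs K}.
Implicit Types (S Q E : set H) (f g : H).

Definition linear_subspace S : Prop := submod_closed (mem S).

Definition closed_subspace S : Prop := closed S /\ linear_subspace S.

Definition closed_span E : set H := closure (smallest linear_subspace E).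

Definition orthogonal_compl S : set H :=
  [set f | forall g, S g -> dot f g = 0].

(* Each of the following three operators is the unique vector with the given
   property when there is one, which is always the case for the orthogonal
   projection onto a closed subspace, for multiplication by a multiplier, and
   for the adjoint of a bounded operator T : Q -> Q on a closed subspace Q. *)
Definition orth_proj Q f : H :=
  xget 0 [set g | Q g /\ orthogonal_compl Q (f - g)].

Definition mul_by (phi : X -> R[i]) f : H :=
  xget 0 [set g | forall z, ev g z = phi z * ev f z].

Definition adjoint Q (T : H -> H) g : H :=
  xget 0 [set h | Q h /\ forall f, Q f -> dot (T f) g = dot f h].

End Subspaces.

Definition disc (R : realType) := {z : R[i] | `|z| < 1}.

Definition polydisc (R : realType) (n : nat) := 'I_n -> disc R.

Definition szego (R : realType) (n : nat) (z w : polydisc R n) : R[i] :=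
  \prod_(i < n) (1 - sval (z i) * Num.conj (sval (w i)))^-1.

(* Holomorphy of the elements is a consequence of the choice of the kernel.
   H^2(D) is [hardy R 1]. *)
Definition hardy (R : realType) (n : nat) := rkhs (@szego R n).

Section HardyModules.
Context {R : realType} {n : nat} {H : hardy R n}.
Implicit Types (S Q E : set H) (i j : 'I_n) (k : 'I_n -> nat).

Definition Mz i : H -> H := mul_by (fun z : polydisc R n => sval (z i)).

Definition Mz_pow k : H -> H :=
  \big[(fun T U => T \o U)/idfun]_(i < n) iter (k i) (Mz i).

Definition submodule S : Prop :=
  closed_subspace S /\ forall i f, S f -> S (Mz i f).

Definition quotient_module Q : Prop :=
  closed_subspace Q /\ submodule (orthogonal_compl Q).

Definition compression Q i : H -> H := orth_proj Q \o Mz i.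

Definition doubly_commuting Q : Prop :=
  quotient_module Q /\
  forall i j, (i < j)%N -> forall f, Q f ->
    compression Q i (adjoint Q (compression Q j) f) =
    adjoint Q (compression Q j) (compression Q i f).

Definition co_doubly_commuting S : Prop :=
  submodule S /\ doubly_commuting (orthogonal_compl S).

Definition generates E S : Prop :=
  E `<=` S /\ closed_span (\bigcup_k (Mz_pow k @` E)) = S.

(* [counting E] is the cardinality of E if E is finite and +oo otherwise, so
   that the infimum is a minimum; all infinite ranks are identified. *)
Definition rank S : \bar R :=
  ereal_inf [set counting E | E in [set E | generates E S]].

(* Q_1 (x) ... (x) Q_n inside H^2(D^n), with f_1 (x) ... (x) f_n identified with
   z |-> f_1(z_1) ... f_n(z_n). *)
Definition tensor (H1 : hardy R 1) (Q : 'I_n -> set H1) : set H :=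
  closed_span [set g | exists2 f : 'I_n -> H1, forall i, Q i (f i) &
    forall z, ev g z = \prod_(i < n) ev (f i) (fun=> z i)].

End HardyModules.

(* Main.v *)
Require Import Defs.
From mathcomp Require Import all_boot all_order all_algebra.
From mathcomp Require Import all_classical all_reals all_analysis.
From mathcomp.real_closed Require Import complex.
From mathcomp Require Import ring lra sesquilinear.

(** The complement of each [Q i] is a submodule of the Hardy space of the disc,
    hence by Beurling's theorem the closed span of the shifts [z^m theta_i] of one
    function [theta_i] which is orthogonal to [z] times that complement.  Let
    [Theta i] be the function [theta_i(z_i)] of [n] variables.

    Upper bound.  The [Theta i] with [Q i] different from the whole space generate
    the submodule [S].  They lie in [S], and it remains to see that a vector [F]
    of [S] orthogonal to all their shifts is zero ([generators_total]).  Decompose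
    each factor of an elementary tensor as [q + s] with [q] in [Q i] and [s] in its
    complement.  Expanding, one gets a tensor of elements of the [Q i], orthogonal
    to [S], and tensors with some factor in the complement of [Q i], which are
    limits of combinations of shifts of [Theta i].  Thus [F] is orthogonal to all
    elementary tensors, in particular to the reproducing kernels.

    Lower bound.  If 1 belongs to every [Q i], then [theta_i] vanishes at the
    origin.  This makes the nonzero [Theta i] mutually orthogonal and orthogonal to
    [z_j S] for every [j] ([Theta_wandering]).  The number of such vectors
    is at most the number of generators, by linear algebra ([rank_ge_orthogonal]).

    Two ingredients have to be obtained from the reproducing kernel alone.  The
    operators (multiplication by a coordinate or by an inner function, tensoring
    with fixed factors) come from one extension theorem for maps that preserve
    Gram matrices ([isometric_extension]).  And Beurling's theorem is proved without
    boundary values: two inner functions [f], [g] with orthogonal ranges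
    are impossible, since [f g] lies in both ranges and has norm one. *)

Set Implicit Arguments.
Unset Strict Implicit.
Unset Printing Implicit Defensive.

Import Order.TTheory GRing.Theory Num.Theory numFieldNormedType.Exports.

Local Open Scope classical_set_scope.
Local Open Scope ring_scope.
Local Open Scope complex_scope.
Local Notation Re := complex.Re.

(** * Estimates in the complex numbers *)

Section ComplexNumbers.
Context {R : realType}.

Lemma normc_Re (a : R[i]) : `|a| = (Re `|a|)%:C.
Proof. by rewrite RRe_real // ger0_real. Qed.

Lemma gtr0_Re (a : R[i]) : 0 < a -> a = (Re a)%:C.
Proof. by move=> /gtr0_real aR; rewrite RRe_real. Qed.

Lemma conjc_real_complex (c : R) : Num.conj c%:C = c%:C.
Proof. by apply/eqP; rewrite -CrealE; apply/complex_realP; exists c. Qed.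

Lemma eq0_small (a : R[i]) (c : R) :
  (forall e : R, 0 < e -> `|a| <= (e * c)%:C) -> a = 0.
Proof.
move=> ha; apply/eqP; rewrite -normr_eq0 normc_Re.
suff -> : Re `|a| = 0 by [].
have a0 : 0 <= Re `|a| by rewrite -lecR -normc_Re normr_ge0.
apply/eqP; rewrite eq_le a0 andbT leNgt; apply/negP => a1.
pose e := Re `|a| / (2 * (`|c| + 1)).
have c1 : 0 < `|c| + 1 by have := normr_ge0 c; lra.
have e0 : 0 < e by rewrite divr_gt0 ?mulr_gt0.
have := ha e e0; rewrite normc_Re lecR => h.
have eE : e * (`|c| + 1) = Re `|a| / 2.
  by rewrite /e; field; rewrite gt_eqF.
have : e * c <= e * (`|c| + 1) by rewrite ler_pM2l // ler_wpDr // ler_norm.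
lra.
Qed.

Lemma invn_lt (e : R) : 0 < e ->
  exists N, forall n, (N <= n)%N -> n.+1%:R^-1 < e :> R.
Proof.
move=> e0; exists (Num.truncn e^-1) => n Nn.
rewrite invf_plt ?posrE // (lt_le_trans (truncnS_gt _)) //.
by rewrite ler_nat ltnS.
Qed.

(** This replaces the identity theorem below: a value bounded by
    [c |w|^m] for all [m] is the value at [w] of a function with a zero of
    infinite order at the origin. *)
Lemma geometric_eq0 (a w : R[i]) (c : R) : `|w| < 1 ->
  (forall m, `|a| <= `|w| ^+ m * c%:C) -> a = 0.
Proof.
move=> w1 aw; have c0 : 0 <= c.
  by have := aw 0; rewrite mul1r -lecR; apply: le_trans; exact: normr_ge0.
have r1 : `|Re `|w| : R| < 1.
  rewrite ger0_norm; last by rewrite -lecR -normc_Re normr_ge0.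
  by rewrite -ltcR -normc_Re.
apply: (eq0_small (c := c)) => e e0; have /cvgrPdist_lt/(_ e e0) := cvg_expr r1.
move=> [m _ /(_ m (leqnn m))] /=; rewrite sub0r normrN => me.
apply: le_trans (aw m) _; rewrite normc_Re -(rmorphXn (real_complex R)).
rewrite -(rmorphM (real_complex R)) lecR ler_wpM2r //.
by rewrite (le_trans (ler_norm _)) // ltW.
Qed.

End ComplexNumbers.

(** * Inner products, norms and orthogonal projections *)

Section Hilbert.
Context {R : realType} {X : Type} {K : X -> X -> R[i]} {H : rkhs K}.
Implicit Types (f g h : H) (a : R[i]) (A B Q E : set H).

Lemma dotDl f g h : dot (f + g) h = dot f h + dot g h.
Proof. exact: linearDl. Qed.

Lemma dotDr f g h : dot f (g + h) = dot f g + dot f h.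
Proof. exact: linearDr. Qed.

Lemma dotBl f g h : dot (f - g) h = dot f h - dot g h.
Proof. exact: linearBl. Qed.

Lemma dotBr f g h : dot f (g - h) = dot f g - dot f h.
Proof. exact: linearBr. Qed.

Lemma dotZl a f g : dot (a *: f) g = a * dot f g.
Proof. exact: linearZl_LR. Qed.

Lemma dotZr a f g : dot f (a *: g) = Num.conj a * dot f g.
Proof. exact: linearZr_LR. Qed.

Lemma dot0l f : dot 0 f = 0.
Proof. exact: linear0l. Qed.

Lemma dot0r f : dot f 0 = 0.
Proof. exact: linear0r. Qed.

Lemma dotC f g : dot f g = Num.conj (dot g f).
Proof. by rewrite (hermC (dot : {dot H for Num.conj})) expr0 mul1r. Qed.

Lemma dot_eq0C f g : dot f g = 0 -> dot g f = 0.
Proof. by move=> fg; rewrite dotC fg rmorph0. Qed.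

(** Norms are values in [R[i]], whose order is partial; the real-valued version
    makes infima and linear arithmetic on norms possible. *)
Definition rnorm f : R := Re `|f|.

Lemma rnormE f : `|f| = (rnorm f)%:C.
Proof. by rewrite RRe_real // ger0_real. Qed.

Lemma rnorm_ge0 f : 0 <= rnorm f.
Proof. by rewrite -lecR -rnormE; exact: normr_ge0. Qed.

Lemma rnormN f : rnorm (- f) = rnorm f.
Proof. by rewrite /rnorm normrN. Qed.

Lemma rnormBC f g : rnorm (f - g) = rnorm (g - f).
Proof. by rewrite /rnorm distrC. Qed.

Lemma ler_rnormD f g : rnorm (f + g) <= rnorm f + rnorm g.
Proof. by rewrite -lecR rmorphD /= -!rnormE; exact: ler_normD. Qed.

Lemma rnorm0 : rnorm 0 = 0.
Proof. by rewrite /rnorm normr0. Qed.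

Lemma rnorm0_eq0 f : rnorm f = 0 -> f = 0.
Proof. by move=> f0; apply/eqP; rewrite -normr_eq0 rnormE f0. Qed.

Lemma dot_rnorm f : dot f f = (rnorm f ^+ 2)%:C.
Proof. by rewrite -norm_dot rnormE -rmorphXn. Qed.

Lemma dot_eq0 f : dot f f = 0 -> f = 0.
Proof.
by rewrite dot_rnorm => /complexI /eqP; rewrite sqrf_eq0 => /eqP /rnorm0_eq0.
Qed.

Lemma rnormZ a f : rnorm (a *: f) = Re `|a| * rnorm f.
Proof.
apply: complexI.
by rewrite -rnormE normrZ {1}normc_Re rnormE (rmorphM (real_complex R)).
Qed.

Lemma dot_gt0 g : g != 0 -> 0 < dot g g.
Proof. exact: neq0_dnorm_gt0. Qed.

(** Pythagoras for the component of [f] orthogonal to [g]; it yields both the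
    Cauchy-Schwarz inequality and the orthogonality of nearest points. *)
Lemma dot_reject f g (r := f - (dot f g / dot g g) *: g) :
  g != 0 -> dot r r = dot f f - `|dot f g| ^+ 2 / dot g g.
Proof.
move=> /dot_gt0 /lt0r_neq0 g0; rewrite /r; set c := _ / _.
have cE : Num.conj c = dot g f / dot g g.
  by rewrite /c rmorphM fmorphV /= -!dotC.
rewrite dotBl !dotBr !dotZl !dotZr normCK -[Num.conj (dot f g)]dotC cE /c.
by field.
Qed.

Lemma CauchySchwarz f g : `|dot f g| <= (rnorm f * rnorm g)%:C.
Proof.
have [->|g0] := eqVneq g 0.
  by rewrite dot0r normr0 rnorm0 mulr0.
have : 0 <= dot f f - `|dot f g| ^+ 2 / dot g g.
  by rewrite -dot_reject // dot_rnorm lecR sqr_ge0.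
rewrite subr_ge0 ler_pdivrMr ?dot_gt0 //.
rewrite !dot_rnorm -(rmorphM (real_complex R)) /= -exprMn rmorphXn /=.
by rewrite ler_pXn2r ?nnegrE // lecR mulr_ge0 ?rnorm_ge0.
Qed.

Lemma closureP A f :
  closure A f <-> forall e : R, 0 < e -> exists2 g, A g & rnorm (f - g) < e.
Proof.
split=> [cA e e0 | hA B /nbhs_normP [e /= e0 eB]].
  have /cA [g [Ag fg]] : nbhs f (ball f e%:C).
    by apply: nbhsx_ballx; rewrite ltcR.
  by exists g => //; rewrite -ltcR -rnormE; move: fg; rewrite -ball_normE.
have eE := gtr0_Re e0.
have [|g Ag fg] := hA (Re e); first by rewrite -ltcR -eE; exact: e0.
exists g; split => //; apply: eB => /=.
by rewrite rnormE eE ltcR.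
Qed.

Lemma closedP A :
  closed A <->
  forall f, (forall e : R, 0 < e -> exists2 g, A g & rnorm (f - g) < e) -> A f.
Proof.
rewrite closure_id; split=> [cA f fA | h]; first by rewrite cA; exact/closureP.
by rewrite eqEsubset; split; [exact: subset_closure | move=> f /closureP /h].
Qed.

Lemma linear_subspaceP A :
  linear_subspace A <-> A 0 /\ forall a f g, A f -> A g -> A (a *: f + g).
Proof.
split=> -[A0 AP]; split.
- by move: A0; rewrite inE.
- by move=> a f g Af Ag; have := AP a f g; rewrite !inE; apply.
- by rewrite inE.
- by move=> a f g; rewrite !inE; exact: AP.
Qed.

Lemma closed_subspaceP A :
  closed_subspace A <->
  [/\ A 0, forall a f g, A f -> A g -> A (a *: f + g) &
   forall f, (forall e : R, 0 < e -> exists2 g, A g & rnorm (f - g) < e) -> A f].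
Proof.
rewrite /closed_subspace linear_subspaceP closedP.
by split=> [[? []]|[]] *; split.
Qed.

Lemma hilbert_complete (u : nat -> H) :
  (forall e : R, 0 < e -> exists N, forall m n, (N <= m)%N -> (N <= n)%N ->
     rnorm (u m - u n) < e) ->
  exists l, forall e : R, 0 < e -> exists N, forall n, (N <= n)%N ->
     rnorm (l - u n) < e.
Proof.
move=> uc.
have cu : cauchy (u @ \oo).
  apply: cauchy_exP => e e0; have eE := gtr0_Re e0.
  have [|N hN] := uc (Re e); first by rewrite -ltcR -eE; exact: e0.
  exists (u N); exists N => // n /= Nn.
  by rewrite -ball_normE /= rnormE eE ltcR; exact: hN.
have ul : u @ \oo --> lim (u @ \oo) := cauchy_cvg _ cu.
set l := lim _ in ul; exists l => e e0; have : nbhs l (ball l e%:C).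
  by apply: nbhsx_ballx; rewrite ltcR.
move=> /ul [N _ hN]; exists N => n /hN /=.
by rewrite -ball_normE /= rnormE ltcR.
Qed.

Lemma subspaceB A f g : linear_subspace A -> A f -> A g -> A (f - g).
Proof.
move=> /linear_subspaceP [_ AP] Af Ag.
by rewrite addrC -scaleN1r; exact: AP.
Qed.

Lemma subspaceZ A a f : linear_subspace A -> A f -> A (a *: f).
Proof.
by move=> /linear_subspaceP [A0 AP] Af; rewrite -[_ *: _]addr0; exact: AP.
Qed.

Lemma subspaceD A f g : linear_subspace A -> A f -> A g -> A (f + g).
Proof.
move=> /linear_subspaceP [_ AP] Af Ag.
by rewrite -[f]scale1r; exact: AP.
Qed.

Lemma parallelogram f g :
  rnorm (f + g) ^+ 2 + rnorm (f - g) ^+ 2 = (rnorm f ^+ 2 + rnorm g ^+ 2) * 2.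
Proof.
rewrite mulr_natr; apply: complexI.
rewrite (rmorphD (real_complex R)) rmorphMn rmorphD /= -!dot_rnorm.
by rewrite dotBl !dotBr dotDl !dotDr mulr2n; ring.
Qed.

(** The parallelogram law makes any minimising sequence for the distance from
    [f] to [Q] a Cauchy sequence.  Its limit [l] is a closest point, and
    subtracting from [f - l] its component along some [g] in [Q] cannot
    shorten it, so that this component vanishes ([dot_reject]). *)
Theorem projection Q f : closed_subspace Q ->
  exists2 q, Q q & orthogonal_compl Q (f - q).
Proof.
move=> [Qc Ql]; have /linear_subspaceP [Q0 QP] := Ql.
pose D := [set rnorm (f - q) | q in Q]; pose d := inf D.
have Dinf : has_inf D.
  by split; [exists (rnorm (f - 0)), 0 | exists 0 => _ [q _ <-]; exact: rnorm_ge0].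
have dle q : Q q -> d <= rnorm (f - q).
  by move=> Qq; apply: ge_inf; [exact: Dinf.2 | exists q].
have d0 : 0 <= d by apply: lb_le_inf Dinf.1 _ => _ [q _ <-]; exact: rnorm_ge0.
have /choice [q qP] : forall n, exists q, Q q /\ rnorm (f - q) < d + n.+1%:R^-1.
  move=> n; have [|_ [q Qq <-]] := @inf_adherent _ D n.+1%:R^-1 _ Dinf.
    by rewrite invr_gt0.
  by exists q.
(* The bound is 4 (d + e)^2 - 4 d^2 <= e (8 d + 4), from the parallelogram law. *)
have close (e : R) m n : 0 < e -> e <= 1 -> m.+1%:R^-1 < e -> n.+1%:R^-1 < e ->
    rnorm (q m - q n) ^+ 2 <= e * (8 * d + 4).
  move=> e0 e1 me ne; have [Qm qm] := qP m; have [Qn qn] := qP n.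
  (* The midpoint of q m and q n lies in Q, hence at distance at least d from f. *)
  have mid : d * 2 <= rnorm ((f - q m) + (f - q n)).
    have -> : (f - q m) + (f - q n) = 2%:R *: (f - 2%:R^-1 *: (q m + q n)).
      rewrite scalerBr scalerA divff ?pnatr_eq0 // scale1r -[2%:R]/(1 + 1).
      by rewrite scalerDl scale1r opprD addrACA.
    rewrite rnormZ normr_nat mulrC; have -> : Re (2%:R : R[i]) = 2 :> R.
      by rewrite -(rmorph_nat (real_complex R)).
    rewrite ler_pM2l //; apply: dle; apply: subspaceZ => //.
    by apply: subspaceD.
  have := parallelogram (f - q m) (f - q n).
  have -> : f - q m - (f - q n) = q n - q m.
    by rewrite opprB addrC addrA addrNK.
  rewrite (rnormBC (q n)) => pl.
  have := rnorm_ge0 (f - q m); have := rnorm_ge0 (f - q n).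
  move: pl qm qn mid; set x := rnorm (_ + _); set y := rnorm (f - q m).
  set z := rnorm (f - q n); set u := m.+1%:R^-1; set v := n.+1%:R^-1.
  move=> pl qm qn mid z0 y0; rewrite -/u in me; rewrite -/v in ne.
  have : y ^+ 2 <= (d + e) ^+ 2 by rewrite ler_pXn2r // ?nnegrE; lra.
  have : z ^+ 2 <= (d + e) ^+ 2 by rewrite ler_pXn2r // ?nnegrE; lra.
  have : (d * 2) ^+ 2 <= x ^+ 2 by rewrite ler_pXn2r // ?nnegrE; lra.
  have : e ^+ 2 <= e by rewrite expr2 ger_pMr.
  nra.
have [|l ql] := hilbert_complete (u := q).
  move=> e e0; pose c := e ^+ 2 / (8 * d + 5).
  have d5 : 0 < 8 * d + 5 by lra.
  have c0 : 0 < c by rewrite divr_gt0 ?exprn_gt0.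
  have c1 : 0 < Num.min c 1 by rewrite lt_min c0 ltr01.
  have [N NP] := invn_lt c1; exists N => m n Nm Nn.
  have := close _ m n c1; rewrite ge_min lexx orbT => /(_ isT (NP _ Nm) (NP _ Nn)).
  move=> mn; rewrite -(ltr_pXn2r (n := 2)) ?nnegrE ?rnorm_ge0 ?ltW //.
  apply: le_lt_trans mn _.
  have : Num.min c 1 <= c by rewrite ge_min lexx.
  have : c * (8 * d + 5) = e ^+ 2 by rewrite /c divfK ?gt_eqF.
  nra.
have Ql' : Q l.
  move/closedP: Qc; apply => e /ql [N /(_ N (leqnn N)) lN].
  by exists (q N) => //; case: (qP N).
have ld : rnorm (f - l) <= d.
  apply/ler_addgt0Pr => e e0; have e2 : 0 < e / 2 by rewrite divr_gt0.
  have [N NP] := ql _ e2; have [N' NP'] := invn_lt e2.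
  have := NP _ (leq_maxl N N'); have := NP' _ (leq_maxr N N').
  have [_] := qP (maxn N N').
  have := ler_rnormD (f - q (maxn N N')) (q (maxn N N') - l).
  rewrite addrA addrNK (rnormBC l); set x := rnorm (f - l).
  set y := rnorm (f - _); set t := rnorm _; set u := _.+1%:R^-1.
  lra.
exists l => // g Qg; have [->|g0] := eqVneq g 0; first by rewrite dot0r.
set r := f - l; pose c := dot r g / dot g g.
have : rnorm r ^+ 2 <= rnorm (r - c *: g) ^+ 2.
  rewrite ler_pXn2r ?nnegrE ?rnorm_ge0 // (le_trans ld) // /r -addrA -opprD.
  by apply: dle; apply: subspaceD => //; exact: subspaceZ.
rewrite -lecR -!dot_rnorm dot_reject // lerBrDr gerDl pmulr_lle0 ?invr_gt0 ?dot_gt0 //.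
by rewrite real_exprn_even_le0 ?normr_real //= normr_eq0 => /eqP.
Qed.

End Hilbert.

(** * Closed subspaces and closed spans *)

Section ClosedSubspaces.
Context {R : realType} {X : Type} {K : X -> X -> R[i]} {H : rkhs K}.
Implicit Types (f g h : H) (a : R[i]) (A B Q E : set H).

Lemma orthogonal_compl_closed Q : closed_subspace (orthogonal_compl Q).
Proof.
apply/closed_subspaceP; split.
- by move=> g _; rewrite dot0l.
- by move=> a f g fQ gQ h Qh; rewrite dotDl dotZl fQ // gQ // mulr0 addr0.
- move=> f fQ h Qh; apply: (@eq0_small _ _ (rnorm h)) => e /fQ [g gQ fg].
  rewrite -[dot f h]subr0 -(gQ _ Qh) -dotBl (le_trans (CauchySchwarz _ _)) //.
  by rewrite lecR ler_wpM2r ?rnorm_ge0 // ltW.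
Qed.

Lemma closed_subspaceI A B :
  closed_subspace A -> closed_subspace B -> closed_subspace (A `&` B).
Proof.
move=> [Ac /linear_subspaceP [A0 AP]] [Bc /linear_subspaceP [B0 BP]].
split; first exact: closedI.
apply/linear_subspaceP; split=> // a f g [Af Bf] [Ag Bg].
by split; [exact: AP | exact: BP].
Qed.

Lemma span_linear E : linear_subspace (smallest linear_subspace E).
Proof.
apply/linear_subspaceP; split=> [A [/linear_subspaceP [] //] | a f g fE gE A AP].
have [/linear_subspaceP [_ AL] _] := AP.
by apply: AL; [exact: fE | exact: gE].
Qed.

Lemma closed_span_closed E : closed_subspace (closed_span E).
Proof.
split; first exact: closed_closure.
have /linear_subspaceP [S0 SP] := span_linear E.
apply/linear_subspaceP; split=> [|a f g /closureP fE /closureP gE].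
  exact: subset_closure.
apply/closureP => e e0; have a0 : 0 <= Re `|a| by rewrite -lecR -normc_Re normr_ge0.
have c0 : 0 < Re `|a| + 1 by lra.
have d0 : 0 < e / ((Re `|a| + 1) * 2) by rewrite divr_gt0 ?mulr_gt0.
have [f' Sf' ff'] := fE _ d0.
have e2 : 0 < e / 2 by rewrite divr_gt0.
have [g' Sg' gg'] := gE _ e2.
exists (a *: f' + g'); first exact: SP.
have -> : a *: f + g - (a *: f' + g') = a *: (f - f') + (g - g').
  by rewrite opprD addrACA scalerBr.
apply: le_lt_trans (ler_rnormD _ _) _; rewrite rnormZ.
suff : Re `|a| * rnorm (f - f') <= e / 2 by move: gg'; set x := rnorm _; lra.
have h : (Re `|a| + 1) * (e / ((Re `|a| + 1) * 2)) = e / 2.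
  by field; rewrite gt_eqF.
by rewrite -h; apply: ler_pM (rnorm_ge0 _) _ (ltW ff') => //; rewrite lerDl ler01.
Qed.

Lemma sub_closed_span E : E `<=` closed_span E.
Proof. by move=> f Ef; apply: subset_closure => A [_]; apply. Qed.

Lemma closed_span_sub E A : closed_subspace A -> E `<=` A -> closed_span E `<=` A.
Proof.
move=> [Ac Al] EA; rewrite [X in _ `<=` X]((closure_id A).1 Ac).
by apply: closure_subset => f; apply.
Qed.

Lemma orth_closed_span E f :
  orthogonal_compl E f -> orthogonal_compl (closed_span E) f.
Proof.
move=> fE g Eg; apply: dot_eq0C.
have : orthogonal_compl [set f] g; last exact.
apply: closed_span_sub Eg; first exact: orthogonal_compl_closed.
by move=> h Eh _ ->; apply/dot_eq0C/fE.
Qed.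

(** The form in which the projection theorem is used: an inclusion of closed
    subspaces is an equality when the relative orthogonal complement is zero. *)
Lemma closed_subspace_eq A B : closed_subspace A -> linear_subspace B ->
  A `<=` B -> (forall f, B f -> orthogonal_compl A f -> f = 0) -> A = B.
Proof.
move=> Ac Bl AB AB0; rewrite eqEsubset; split=> // f Bf.
have [q Aq fq] := projection f Ac.
have /eqP := AB0 _ (subspaceB Bl Bf (AB _ Aq)) fq.
by rewrite subr_eq0 => /eqP ->.
Qed.

Lemma orthogonal_complK Q : closed_subspace Q ->
  orthogonal_compl (orthogonal_compl Q) = Q.
Proof.
move=> Qc; symmetry; apply: closed_subspace_eq => //.
- exact: (orthogonal_compl_closed _).2.
- by move=> f Qf g gQ; apply/dot_eq0C/gQ.
- by move=> f fQ fQ'; apply: dot_eq0; exact: fQ.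
Qed.

Lemma total_closed_span E : (forall f, orthogonal_compl E f -> f = 0) ->
  closed_span E = setT.
Proof.
move=> E0; apply: closed_subspace_eq => //; first exact: closed_span_closed.
- by apply/linear_subspaceP.
- by move=> f _ fE; apply: E0 => g Eg; apply/fE/sub_closed_span.
Qed.

Lemma eq_ev f g : (forall w, ev f w = ev g w) -> f = g.
Proof. by move=> fg; apply: ev_inj; apply: funext. Qed.

(** Evaluation as an inner product turns pointwise identities into linear
    conditions that pass to closed spans. *)
Lemma ev_dot f w : ev f w = dot f (kern H w).
Proof. by rewrite reproducing. Qed.

Lemma ev0 w : ev (0 : H) w = 0.
Proof. by rewrite ev_dot dot0l. Qed.

Lemma kern_total f : (forall w, dot f (kern H w) = 0) -> f = 0.
Proof.
by move=> fk; apply: eq_ev => w; rewrite ev0 ev_dot fk.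
Qed.

Lemma evD f g w : ev (f + g) w = ev f w + ev g w.
Proof. by rewrite !ev_dot dotDl. Qed.

Lemma evB f g w : ev (f - g) w = ev f w - ev g w.
Proof. by rewrite !ev_dot dotBl. Qed.

Lemma evZ a f w : ev (a *: f) w = a * ev f w.
Proof. by rewrite !ev_dot dotZl. Qed.

End ClosedSubspaces.

(** * Extension of isometries *)

Section Isometries.
Context {R : realType} {X X' : Type} {K : X -> X -> R[i]} {K' : X' -> X' -> R[i]}.
Context {H : rkhs K} {H' : rkhs K'}.

(** A closed linear relation under which the second member is controlled by
    the first one has a closed domain: along a convergent sequence in the domain
    the second members form a Cauchy sequence. *)
Lemma closed_domain (P : H -> H' -> Prop) (c : R) :
  P 0 0 ->
  (forall a h g h' g', P h g -> P h' g' -> P (a *: h + h') (a *: g + g')) ->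
  (forall h g, (forall e : R, 0 < e -> exists h' g',
     [/\ P h' g', rnorm (h - h') < e & rnorm (g - g') < e]) -> P h g) ->
  (forall h g, P h g -> rnorm g <= c * rnorm h) ->
  closed_subspace [set h | exists g, P h g].
Proof.
move=> P0 PL Pc Pb; apply/closed_subspaceP; split=> [|a h h' [g Pg] [g' Pg']|h hP].
- by exists 0.
- by exists (a *: g + g'); exact: PL.
have /choice [hn hnP] : forall n, exists h', (exists g, P h' g) /\
    rnorm (h - h') < n.+1%:R^-1.
  by move=> n; have [|h' ? ?] := hP n.+1%:R^-1; [rewrite invr_gt0 | exists h'].
have /choice [gn gnP] : forall n, exists g, P (hn n) g by move=> n; case: (hnP n).
have [|g gP] := hilbert_complete (u := gn).
  move=> e e0; pose c' := `|c| + 1.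
  have c'0 : 0 < c' by rewrite /c'; have := normr_ge0 c; lra.
  have d0 : 0 < e / (c' * 2) by rewrite divr_gt0 ?mulr_gt0.
  have [N NP] := invn_lt d0; exists N => m n Nm Nn.
  have Pmn : P (hn m - hn n) (gn m - gn n).
    have := PL (-1) _ _ _ _ (gnP n) (gnP m).
    by rewrite !scaleN1r [- hn n + _]addrC [- gn n + _]addrC.
  apply: le_lt_trans (Pb _ _ Pmn) _.
  have hmn : rnorm (hn m - hn n) < e / c'.
    have -> : hn m - hn n = (h - hn n) - (h - hn m).
      by rewrite opprB [RHS]addrC addrA addrNK.
    apply: le_lt_trans (ler_rnormD _ _) _; rewrite rnormN.
    have := lt_trans (hnP m).2 (NP _ Nm); have := lt_trans (hnP n).2 (NP _ Nn).
    have -> : e / c' = e / (c' * 2) + e / (c' * 2) by field; rewrite gt_eqF.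
    by move=> ? ?; rewrite ltrD.
  apply: (@le_lt_trans _ _ (c' * rnorm (hn m - hn n))).
    by rewrite ler_wpM2r ?rnorm_ge0 // /c' ler_wpDr // ler_norm.
  by rewrite -lter_pdivlMl // mulrC.
exists g; apply: Pc => e e0; have [N NP] := gP _ e0; have [N' NP'] := invn_lt e0.
exists (hn (maxn N N')), (gn (maxn N N')); split=> //.
- exact: lt_trans (hnP _).2 (NP' _ (leq_maxr _ _)).
- exact: NP (leq_maxl _ _).
Qed.

Lemma rnorm_scaled (h : H) (g : H') (c : R) :
  dot g g = c%:C * dot h h -> rnorm g <= (`|c| + 1) * rnorm h.
Proof.
rewrite !dot_rnorm -(rmorphM (real_complex R)) => /complexI gh.
rewrite -(ler_pXn2r (n := 2)) ?nnegrE ?mulr_ge0 ?addr_ge0 ?rnorm_ge0 //.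
rewrite gh exprMn ler_wpM2r ?sqr_ge0 //.
by have := ler_norm c; have := normr_ge0 c; nra.
Qed.

Lemma closed_subspace_preimage (T : H -> H') (c : R) (A : set H') :
  (forall a h h', T (a *: h + h') = a *: T h + T h') ->
  (forall h, rnorm (T h) <= c * rnorm h) ->
  closed_subspace A -> closed_subspace (T @^-1` A).
Proof.
move=> TL Tb /closed_subspaceP [A0 AL Ac].
have T0 : T 0 = 0.
  by have := TL (-1) 0 0; rewrite !scaleN1r oppr0 addr0 addNr.
have TB h h' : T h - T h' = T (h - h').
  by have := TL (-1) h' h; rewrite !scaleN1r addrC => ->; rewrite addrC.
apply/closed_subspaceP; split=> [|a h h' Ah Ah'|h hA] /=.
- by rewrite T0.
- by rewrite TL; exact: AL.
- apply: Ac => e e0; have c0 : 0 < `|c| + 1 by have := normr_ge0 c; lra.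
  have d0 : 0 < e / (`|c| + 1) by rewrite divr_gt0.
  have [h' Ah' hh'] := hA _ d0; exists (T h') => //; rewrite TB.
  apply: le_lt_trans (Tb _) _; rewrite ltr_pdivlMr // mulrC in hh'.
  apply: le_lt_trans hh'; rewrite ler_wpM2r ?rnorm_ge0 //.
  by rewrite ler_wpDr // ler_norm.
Qed.

(** If [e] has the Gram matrix of a total family [d] up to the factor [c],
    then [d i |-> e i] extends to a multiple [T] of an isometry on all of [H].
    Its value [g = T h] is described here by its inner products: the condition on
    [x] and [y] says that [x] is the image of [y] under the adjoint of [T].
    Every operator below arises from this theorem, and its properties are read
    off by a suitable choice of [x] and [y]. *)
Theorem isometric_extension (I : Type) (d : I -> H) (e : I -> H') (c : R) :
  (forall f, (forall i, dot f (d i) = 0) -> f = 0) ->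
  (forall i j, dot (e i) (e j) = c%:C * dot (d i) (d j)) ->
  forall h, exists g, forall x y,
    (forall i, dot (e i) y = dot (d i) x) -> dot g y = dot h x.
Proof.
move=> dT ed h.
pose P h g := forall x y, (forall i, dot (e i) y = dot (d i) x) -> dot g y = dot h x.
have PC : closed_subspace [set h | exists g, P h g].
  apply: (@closed_domain P (`|c| + 1)).
  - by move=> x y _; rewrite !dot0l.
  - move=> a h1 g1 h2 g2 P1 P2 x y xy.
    by rewrite !dotDl !dotZl (P1 _ _ xy) (P2 _ _ xy).
  - move=> h1 g1 hg x y xy; apply/eqP; rewrite -subr_eq0; apply/eqP.
    apply: (@eq0_small _ _ (rnorm y + rnorm x)) => t /hg [h2 [g2 [P2 ht gt]]].
    have -> : dot g1 y - dot h1 x = dot (g1 - g2) y - dot (h1 - h2) x.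
      by rewrite !dotBl (P2 _ _ xy) opprB addrA addrNK.
    rewrite (le_trans (ler_normB _ _)) // mulrDr (rmorphD (real_complex R)) lerD //.
    + rewrite (le_trans (CauchySchwarz _ _)) // lecR ler_wpM2r ?rnorm_ge0 //.
      exact: ltW.
    + rewrite (le_trans (CauchySchwarz _ _)) // lecR ler_wpM2r ?rnorm_ge0 //.
      exact: ltW.
  - move=> h1 g1 P1.
    (* Both (c d_i, e_i) and then (c h1, g1) are admissible pairs (x, y). *)
    have g1e i : dot g1 (e i) = c%:C * dot h1 (d i).
      rewrite -[c%:C]conjc_real_complex -dotZr; apply: P1 => j.
      by rewrite ed dotZr conjc_real_complex.
    apply: rnorm_scaled; rewrite -[c%:C]conjc_real_complex -dotZr; apply: P1 => i.
    by rewrite dotC g1e rmorphM /= conjc_real_complex -dotC dotZr conjc_real_complex.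
suff : closed_span [set d i | i in setT] `<=` [set h | exists g, P h g].
  rewrite total_closed_span; first by apply.
  by move=> f fd; apply: dT => i; apply: fd; exists i.
by apply: closed_span_sub => // _ [i _ <-]; exists (e i) => x y; apply.
Qed.

End Isometries.

(** * Changing one coordinate *)

Section Update.
Context {n : nat} {T : Type}.
Implicit Types (x : 'I_n -> T) (i : 'I_n) (a : T).

Definition update x i a : 'I_n -> T := fun j => if j == i then a else x j.

Lemma updateE x i : update x i (x i) = x.
Proof. by apply: funext => j; rewrite /update; case: eqP => [->|]. Qed.

Lemma update_eq x i a : update x i a i = a.
Proof. by rewrite /update eqxx. Qed.

Lemma update_neq x i a j : j != i -> update x i a j = x j.
Proof. by rewrite /update => /negPf ->. Qed.

(** To pass from families with entries in [A i] to families with entries in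
    [B i] it is enough to change one entry at a time.  The induction is over
    hybrid families whose first [m] entries are already in [B]. *)
Theorem coordinatewise (A B : 'I_n -> set T) (P : ('I_n -> T) -> Prop) :
  (forall i x, (forall a, A i a -> P (update x i a)) ->
     forall b, B i b -> P (update x i b)) ->
  (forall x, (forall i, A i (x i)) -> P x) ->
  forall x, (forall i, B i (x i)) -> P x.
Proof.
move=> step base.
have hybrid m : (m <= n)%N -> forall x : 'I_n -> T,
    (forall i : 'I_n, (i < m)%N -> B i (x i)) ->
    (forall i : 'I_n, (m <= i)%N -> A i (x i)) -> P x.
  elim: m => [_ x _ xA|m IH mn x xB xA]; first by apply: base => i; exact: xA.
  pose i := Ordinal mn; rewrite -(updateE x i); apply: step (xB i (leqnn _)).
  move=> a Aa; apply: IH => [|j jm|j mj]; first exact: ltnW.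
  - rewrite update_neq; first by apply: xB; exact: ltnW.
    by rewrite -(inj_eq val_inj) /= ltn_eqF.
  - have [->|ji] := eqVneq j i; first by rewrite update_eq.
    rewrite update_neq //; apply: xA; rewrite ltn_neqAle mj andbT eq_sym.
    by rewrite -(inj_eq val_inj) in ji.
move=> x xB; apply: (hybrid n (leqnn n)) => [i _|i]; first exact: xB.
by rewrite leqNgt ltn_ord.
Qed.

End Update.

(** * The Szego kernel and the coordinate multiplications *)

Section Szego.
Context {R : realType} {n : nat}.
Implicit Types (z w : polydisc R n) (i : 'I_n) (a b : disc R).

Definition disc0 : disc R := exist (fun z : R[i] => `|z| < 1) 0
  (eq_ind_r (fun x => is_true (x < 1)) ltr01 (normr0 _)).

Lemma subr_mul_neq0 a b : 1 - sval a * Num.conj (sval b) != 0.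
Proof.
rewrite subr_eq0 eq_sym; apply/eqP => /(congr1 Num.norm)/eqP.
rewrite normrM norm_conjC normr1 lt_eqF // mulr_ilt1 ?normr_ge0 //.
- exact: (svalP a).
- exact: (svalP b).
Qed.

Lemma szego_update z w i a b :
  szego (update z i a) (update w i b) = (1 - sval a * Num.conj (sval b))^-1 *
    \prod_(j < n | j != i) (1 - sval (z j) * Num.conj (sval (w j)))^-1.
Proof.
rewrite /szego (bigD1 i) //= !update_eq; congr (_ * _).
by apply: eq_bigr => j ji; rewrite !update_neq.
Qed.

Lemma szego_split z w i :
  szego z w = (1 - sval (z i) * Num.conj (sval (w i)))^-1 * szego z (update w i disc0).
Proof.
have := szego_update z w i (z i) (w i); rewrite !updateE => ->.
have := szego_update z w i (z i) disc0; rewrite updateE => ->.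
by rewrite /= rmorph0 mulr0 subr0 invr1 mul1r.
Qed.

End Szego.
Arguments disc0 {R}.

Section CoordinateMultiplication.
Context {R : realType} {n : nat} {H : hardy R n}.
Implicit Types (f g h : H) (z w : polydisc R n) (i : 'I_n).

Lemma dot_kern z w : dot (kern H w) (kern H z) = szego z w.
Proof. by rewrite reproducing ev_kern. Qed.

(** The kernels at points with [w_i <> 0] are total, because the remaining
    ones are limits of them as the [i]-th coordinate tends to zero.  For these
    [w] the product [z_i k_w] is a combination of two kernels. *)
Lemma kern_total_neq0 i f :
  (forall w, sval (w i) != 0 -> dot f (kern H w) = 0) -> f = 0.
Proof.
move=> fk; apply: kern_total => w; have [w0|] := eqVneq (sval (w i)) 0; last exact: fk.
apply: (@eq0_small _ _ (rnorm f * (rnorm (kern H w) * 2))) => e e0.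
pose t : R := Num.min e 2^-1.
have t0 : 0 < t by rewrite lt_min e0 /= invr_gt0 ltr0n.
have te : t <= e by rewrite ge_min lexx.
have t2 : t <= 2^-1 by rewrite ge_min lexx orbT.
have t1 : `|t%:C : R[i]| < 1.
  rewrite ger0_norm ?ler0c ?ltW // -[X in _ < X]/(1%:C) ltcR; lra.
pose wt := update w i (exist (fun z : R[i] => `|z| < 1) _ t1).
have wti : sval (wt i) = t%:C by rewrite /wt update_eq.
have wE : w = update w i disc0.
  apply: funext => j; rewrite /update; case: eqP => [->|//].
  exact: val_inj.
set P := \prod_(j < n | j != i) (1 - sval (w j) * Num.conj (sval (w j)))^-1.
have PE : dot (kern H w) (kern H w) = P.
  rewrite dot_kern {1 2}wE szego_update -/P.
  by rewrite /= mul0r subr0 invr1 mul1r.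
have wt_w : dot (kern H wt) (kern H w) = P.
  rewrite dot_kern {1}wE szego_update -/P.
  by rewrite /= mul0r subr0 invr1 mul1r.
have wt_wt : dot (kern H wt) (kern H wt) = ((1 - t ^+ 2)^-1)%:C * P.
  rewrite dot_kern szego_update -/P /=; congr (_ * _).
  by rewrite [Num.conj _]conjc_real_complex -(rmorphM (real_complex R))
    -[1]/(1%:C) -(rmorphB (real_complex R)) -(fmorphV (real_complex R)).
have P_real : Num.conj P = P by rewrite -PE -dotC.
rewrite -[dot f _]subr0 -(fk wt); last first.
  by rewrite wti; apply/eqP => /complexI t00; rewrite t00 ltxx in t0.
rewrite -dotBr (le_trans (CauchySchwarz _ _)) // lecR mulrCA.
rewrite ler_wpM2l ?rnorm_ge0 // -(ler_pXn2r (n := 2)) ?nnegrE ?rnorm_ge0 //; last first.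
  by rewrite !mulr_ge0 ?rnorm_ge0 // ltW.
(* |k_w - k_wt|^2 = t^2 / (1 - t^2) |k_w|^2, at most (2 t |k_w|)^2 as t <= 1/2. *)
have -> : rnorm (kern H w - kern H wt) ^+ 2 =
    ((1 - t ^+ 2)^-1 - 1) * rnorm (kern H w) ^+ 2.
  apply: complexI; rewrite -dot_rnorm (rmorphM (real_complex R)) /= -dot_rnorm.
  rewrite dotBl !dotBr wt_wt wt_w [dot (kern H w) (kern H wt)]dotC wt_w P_real PE.
  by rewrite subrr sub0r opprB (rmorphB (real_complex R)) mulrBl mul1r.
rewrite (_ : (e * (_ * 2)) ^+ 2 = (e * 2) ^+ 2 * rnorm (kern H w) ^+ 2); last by ring.
rewrite ler_wpM2r ?sqr_ge0 //.
have t21 : 0 < 1 - t ^+ 2 by nra.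
rewrite -(ler_pM2r t21). 
rewrite mulrBl mulVf ?gt_eqF //.
have : t ^+ 2 <= e ^+ 2 by rewrite ler_pXn2r // nnegrE ltW.
have t4 : t ^+ 2 <= 4^-1 by nra.
have : 0 <= e ^+ 2 * (4^-1 - t ^+ 2) by rewrite mulr_ge0 ?sqr_ge0 // subr_ge0.
rewrite exprMn mulrBr; move: (sqr_ge0 e) t4; set T := t ^+ 2; set E := e ^+ 2; lra.
Qed.

(** The coordinate function multiplies the kernel [k_w] into
    [(k_w - k_w0) / conj w_i], where [w0] is [w] with [i]-th coordinate zero;
    this has the same Gram matrix as the kernels, whence a multiplication operator
    which is isometric. *)
Lemma Mz_exists i f : exists g, (forall z, ev g z = sval (z i) * ev f z) /\
  forall h h', (forall z, ev h' z = sval (z i) * ev h z) -> dot g h' = dot f h.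
Proof.
pose I := {w : polydisc R n | sval (w i) != 0}.
pose d (w : I) := kern H (sval w).
pose e (w : I) := (Num.conj (sval (sval w i)))^-1 *:
  (kern H (sval w) - kern H (update (sval w) i disc0)).
have eE (w : I) z : ev (e w) z = sval (z i) * ev (d w) z.
  rewrite evZ evB !ev_kern (szego_split _ _ i).
  set s := szego _ (update _ _ _); have := subr_mul_neq0 (z i) (sval w i).
  have : Num.conj (sval (sval w i)) != 0 by rewrite conjC_eq0 (svalP w).
  by move: (Num.conj _) (sval (z i)) => b a b0 ab0; field; rewrite ab0 b0.
have eT (w : I) h h' : (forall z, ev h' z = sval (z i) * ev h z) ->
    dot (e w) h' = dot (d w) h.
  move=> hh'; rewrite dotZl dotBl ![dot (kern H _) _]dotC !reproducing !hh' update_eq.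
  rewrite /= mul0r rmorph0 subr0 rmorphM /= mulKf //.
  by rewrite conjC_eq0 (svalP w).
have dT g : (forall x, dot g (d x) = 0) -> g = 0.
  by move=> gd; apply: (kern_total_neq0 (i := i)) => w w0; exact: gd (exist _ w w0).
have ed (w v : I) : dot (e w) (e v) = 1%:C * dot (d w) (d v).
  by rewrite mul1r; apply: eT => z; exact: eE.
have [g gP] := isometric_extension dT ed f; exists g; split=> [z|h h' hh'].
  rewrite -!reproducing (gP (Num.conj (sval (z i)) *: kern H z)); last first.
    by move=> x; rewrite dotZr conjCK !reproducing eE.
  by rewrite dotZr conjCK.
by apply: gP => x; exact: eT.
Qed.

Lemma ev_Mz i f z : ev (Mz i f) z = sval (z i) * ev f z.
Proof.
have [g [gP _]] := Mz_exists i f.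
by rewrite /Mz /mul_by; case: xgetP => [h _ -> //|/(_ g)]; case.
Qed.

Lemma dot_Mz i f g : dot (Mz i f) (Mz i g) = dot f g.
Proof.
have [h [hE hP]] := Mz_exists i f.
have -> : Mz i f = h by apply: eq_ev => z; rewrite hE ev_Mz.
by apply: hP => z; exact: ev_Mz.
Qed.

Lemma rnorm_Mz i f : rnorm (Mz i f) = rnorm f.
Proof.
apply/eqP; rewrite -(eqrXn2 (n := 2)) ?rnorm_ge0 //; apply/eqP/complexI.
by rewrite -!dot_rnorm dot_Mz.
Qed.

Lemma Mz_linear i (a : R[i]) f g : Mz i (a *: f + g) = a *: Mz i f + Mz i g.
Proof.
by apply: eq_ev => z; rewrite !(ev_Mz, evD, evZ) mulrDr mulrCA.
Qed.

Lemma ev_iter_Mz i m f z : ev (iter m (Mz i) f) z = sval (z i) ^+ m * ev f z.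
Proof.
by elim: m => [|m IH] /=; rewrite ?mul1r // ev_Mz IH exprS mulrA.
Qed.

Lemma dot_iter_Mz i m f g : dot (iter m (Mz i) f) (iter m (Mz i) g) = dot f g.
Proof. by elim: m => //= m IH; rewrite dot_Mz. Qed.

Lemma ev_Mz_pow (k : 'I_n -> nat) f z :
  ev (Mz_pow k f) z = (\prod_(i < n) sval (z i) ^+ k i) * ev f z.
Proof.
rewrite /Mz_pow; elim/big_rec2: _ f => [|i y T _ IH] f; first by rewrite mul1r.
by rewrite /= ev_iter_Mz IH mulrA.
Qed.

End CoordinateMultiplication.

(** * Inner functions and Beurling's theorem *)

Section Beurling.
Context {R : realType} {H : hardy R 1}.
Implicit Types (f g h : H) (z w : polydisc R 1) (N : set H) (k l m : nat).

Local Notation M := (@Mz R 1 H ord0).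

Definition one : H := kern H (fun=> disc0).

Lemma ev_one z : ev one z = 1.
Proof.
by rewrite ev_kern /szego big1 // => i _; rewrite /= rmorph0 mulr0 subr0 invr1.
Qed.

Lemma dot_one f : dot f one = ev f (fun=> disc0).
Proof. exact: reproducing. Qed.

Lemma ev_bound f w : `|ev f w| <= (rnorm f * rnorm (kern H w))%:C.
Proof. by rewrite -reproducing CauchySchwarz. Qed.

(** From [k_w = 1 + conj w z k_w] follows
    [<f, k_w> = w^m <f, z^m k_w>] for every [m] as soon as [f] is orthogonal to
    all monomials, and the right-hand side tends to zero. *)
Lemma monomials_total f : (forall m, dot f (iter m M one) = 0) -> f = 0.
Proof.
move=> fm; apply: kern_total => w; set a := Num.conj (sval (w ord0)).
have kE m : iter m M (kern H w) = iter m M one + a *: iter m.+1 M (kern H w).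
  apply: eq_ev => z; rewrite evD evZ !ev_iter_Mz ev_one ev_kern.
  rewrite /szego big_ord1 -/a exprS; have := subr_mul_neq0 (z ord0) (w ord0).
  by rewrite -/a => nz; field.
have fE m : dot f (kern H w) = sval (w ord0) ^+ m * dot f (iter m M (kern H w)).
  elim: m => [|m ->]; first by rewrite mul1r.
  by rewrite kE dotDr fm add0r dotZr conjCK exprSr mulrA.
apply: (@geometric_eq0 _ _ (sval (w ord0)) (rnorm f * rnorm (kern H w))) => [|m].
  exact: (svalP (w ord0)).
rewrite (fE m) normrM normrX ler_wpM2l ?exprn_ge0 //.
have -> : rnorm (kern H w) = rnorm (iter m M (kern H w)).
  by elim: m => //= m ->; rewrite rnorm_Mz.
exact: CauchySchwarz.
Qed.

(** A vector orthogonal to all its shifts has mutually orthogonal shifts, as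
    the shift is isometric. *)
Lemma dot_iter_wandering f k l : (forall m, dot (iter m.+1 M f) f = 0) ->
  dot (iter k M f) (iter l M f) = (k == l)%:R * dot f f.
Proof.
move=> fM; have kl d m : dot (iter (m + d.+1) M f) (iter m M f) = 0.
  by rewrite iterD dot_iter_Mz.
have [kl'|lk|->] := ltngtP k l; last by rewrite dot_iter_Mz mul1r.
- by rewrite mul0r -(subnKC kl') addSnnS; apply/dot_eq0C/kl.
- by rewrite mul0r -(subnKC lk) addSnnS; apply/kl.
Qed.

(** A unit vector [f] orthogonal to its shifts is an inner function: the map
    [z^m |-> z^m f] preserves Gram matrices, and its isometric extension is
    multiplication by [f]. *)
Lemma inner_multiplication f h : dot f f = 1 ->
  (forall m, dot (iter m.+1 M f) f = 0) -> exists g,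
  [/\ forall z, ev g z = ev f z * ev h z,
      closed_span [set iter m M f | m in setT] g & dot g g = dot h h].
Proof.
move=> f1 fM; pose d m := iter m M one; pose e m := iter m M f.
have d_e k l : dot (e k) (e l) = 1%:C * dot (d k) (d l).
  rewrite /e /d !dot_iter_wandering // => [|m]; last first.
    by rewrite dot_one ev_iter_Mz /= exprS !mul0r.
  by rewrite f1 dot_one ev_one !mul1r.
have [g gP] := isometric_extension monomials_total d_e h; exists g; split.
- move=> z; rewrite -reproducing (gP (Num.conj (ev f z) *: kern H z)).
    by rewrite dotZr conjCK reproducing.
  by move=> m; rewrite dotZr conjCK !reproducing !ev_iter_Mz ev_one mulr1 mulrC.
- rewrite -[closed_span _]orthogonal_complK; last exact: closed_span_closed.
  move=> y yL; rewrite (gP 0) ?dot0r // => m; rewrite dot0r.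
  by apply/dot_eq0C/yL/sub_closed_span; exists m.
- apply: (gP) => m; rewrite [LHS]dotC [RHS]dotC; congr (Num.conj _).
  by apply: gP => k; rewrite d_e mul1r.
Qed.

(** If a submodule [N] had no wandering vector then [N = z N], so every
    [f] in [N] would be [z^m g] with [g] of the same norm, and [f] would vanish to
    infinite order at the origin. *)
Lemma wandering_vector N f : submodule N -> N f -> f != 0 ->
  exists g, [/\ N g, dot g g = 1 & forall h, N h -> dot (M h) g = 0].
Proof.
move=> [Nc NM] Nf f0; apply: contrapT => noW.
have W0 g : N g -> (forall h, N h -> dot (M h) g = 0) -> g = 0.
  move=> Ng gM; apply/eqP; apply: contraT => g0; exfalso; apply: noW.
  have n0 : rnorm g != 0 by apply: contra_neq g0; exact: rnorm0_eq0.
  exists ((rnorm g)^-1%:C *: g); split.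
  - by apply: subspaceZ => //; exact: Nc.2.
  - rewrite dotZl dotZr dot_rnorm.
    by rewrite conjc_real_complex -!(rmorphM (real_complex R)) expr2 mulKf // mulVf.
  - by move=> h Nh; rewrite dotZr gM // mulr0.
have [N0 NP] := (linear_subspaceP _).1 Nc.2.
have MN : [set h | exists g, N g /\ h = M g] = N.
  apply: closed_subspace_eq _ Nc.2 _ _ => [|_ [g [Ng ->]]|g Ng gM]; last 1 first.
  - by apply: W0 => // h Nh; apply/dot_eq0C/gM; exists h.
  - apply: (closed_domain (P := fun h g => N g /\ h = M g) (c := 1)).
    + split=> //; apply: eq_ev => z.
      by rewrite ev_Mz ev0 mulr0.
    + move=> a h g h' g' [Ng ->] [Ng' ->]; split; first exact: NP.
      by rewrite Mz_linear.
    + move=> h g hg; split.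
        by move/closedP: Nc.1; apply => e /hg [_ [g' [[Ng' _] _ gg']]]; exists g'.
      apply/eqP; rewrite -subr_eq0; apply/eqP/rnorm0_eq0/complexI.
      rewrite -rnormE -[`|_|]normr_id; apply/eqP; rewrite normr_eq0; apply/eqP.
      apply: (@eq0_small _ _ 2) => e /hg [_ [g' [[_ ->] hg' gg']]].
      rewrite normr_id rnormE lecR mulr_natr mulr2n.
      have -> : h - M g = (h - M g') + M (g' - g).
        by apply: eq_ev => z; rewrite !(evB, evD, ev_Mz); ring.
      apply: le_trans (ler_rnormD _ _) _; rewrite rnorm_Mz (rnormBC g').
      by rewrite lerD // ltW.
    + by move=> h g [_ ->]; rewrite rnorm_Mz mul1r.
  - exact: NM.
have fM m : exists2 g, N g & f = iter m M g.
  elim: m => [|m [g Ng ->]]; first by exists f.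
  by move: Ng; rewrite -{1}MN => -[g' [Ng' ->]]; exists g' => //; rewrite iterSr.
suff /eqP : f = 0 by rewrite (negPf f0).
apply: eq_ev => w; rewrite ev0.
apply: (@geometric_eq0 _ _ (sval (w ord0)) (rnorm f * rnorm (kern H w))) => [|m].
  exact: (svalP (w ord0)).
have [g _ fg] := fM m; rewrite fg ev_iter_Mz normrM normrX.
have -> : rnorm (iter m M g) = rnorm g.
  by elim: (m) => //= m' <-; rewrite rnorm_Mz.
by rewrite ler_wpM2l ?exprn_ge0 // ev_bound.
Qed.

(** Let [theta] be a wandering vector of [N] and [L] the closed span of its
    shifts.  The complement [N'] of [L] in [N] is again a submodule.  If it had a
    wandering vector [g], both [theta] and [g] would be inner, so [theta g]
    would belong to [L] as a multiple of [theta] and to [N'] as a multiple of [g].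
    Thus [theta g = 0], against [|theta g| = |g| = 1]. *)
Theorem Beurling N : submodule N -> exists theta,
  [/\ N theta, forall g, N g -> dot (M g) theta = 0 &
      N = closed_span [set iter m M theta | m in setT]].
Proof.
move=> Nsub; have [Nc NM] := Nsub; have [N0 NP] := (linear_subspaceP _).1 Nc.2.
have iterN P g m : submodule P -> P g -> P (iter m M g).
  by move=> [_ PM] Pg; elim: m => //= m; exact: PM.
have [[f Nf f0]|N_0] := pselect (exists2 f, N f & f != 0); last first.
  have NE : N = [set 0].
    rewrite eqEsubset; split=> [g Ng|_ ->//]; apply: contrapT => /eqP g0.
    by apply: N_0; exists g.
  exists 0; split=> // [g _|]; first by rewrite dot0r.
  have M0 m : iter m M 0 = 0.
    by apply: eq_ev => z; rewrite ev_iter_Mz ev0 mulr0.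
  rewrite eqEsubset; split; last by apply: closed_span_sub => // _ [m _ <-]; rewrite M0.
  by rewrite NE => _ ->; apply: sub_closed_span; exists 0%N.
have [theta [Nt t1 tM]] := wandering_vector Nsub Nf f0.
exists theta; split=> //; symmetry.
set L := closed_span _; have LN : L `<=` N.
  by apply: closed_span_sub => // _ [m _ <-]; exact: iterN.
apply: closed_subspace_eq _ Nc.2 LN _ => [|h0 Nh0 h0L]; first exact: closed_span_closed.
pose N' := N `&` orthogonal_compl L.
have N'sub : submodule N'.
  split; first by apply: closed_subspaceI => //; exact: orthogonal_compl_closed.
  move=> i h [Nh hL]; rewrite (ord1 i); split; first exact: NM.
  apply: orth_closed_span => _ [m _ <-]; case: m => [|m]; first exact: tM.
  by rewrite /= dot_Mz; apply/hL/sub_closed_span; exists m.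
apply/eqP; apply: contraT => h00; exfalso.
have [g [N'g g1 gM]] := wandering_vector N'sub (conj Nh0 h0L) h00.
have [|p [pE pL pp]] := inner_multiplication g t1.
  by move=> m; exact: tM (iterN _ _ m Nsub Nt).
have [|p' [p'E p'L _]] := inner_multiplication theta g1.
  by move=> m; exact: gM (iterN _ _ m N'sub N'g).
have p'p : p' = p by apply: eq_ev => z; rewrite p'E pE mulrC.
have [_ pL'] : N' p.
  rewrite -p'p; apply: closed_span_sub p'L; first exact: N'sub.1.
  by move=> _ [m _ <-]; exact: iterN.
by have /eqP := pL' _ pL; rewrite pp g1 oner_eq0.
Qed.

End Beurling.

(** * Elementary tensors *)

Section Tensors.
Context {R : realType} {n : nat} {H1 : hardy R 1} {H : hardy R n}.
Implicit Types (f : 'I_n -> H1) (h : H1) (g F : H) (i j : 'I_n) (z w : polydisc R n).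

Definition pure_tensor f g : Prop :=
  forall z, ev g z = \prod_(i < n) ev (f i) (fun=> z i).

Lemma pure_tensor_kern z :
  pure_tensor (fun i => kern H1 (fun=> z i)) (kern H z).
Proof.
by move=> w; rewrite ev_kern; apply: eq_bigr => i _; rewrite ev_kern /szego big_ord1.
Qed.

Lemma prod_update f f' i h :
  \prod_(j < n) dot (update f i h j) (f' j) =
  dot h (f' i) * \prod_(j < n | j != i) dot (f j) (f' j).
Proof.
rewrite (bigD1 i) //= update_eq; congr (_ * _).
by apply: eq_bigr => j ji; rewrite update_neq.
Qed.

Lemma prod_dot_real f (P : pred 'I_n) :
  \prod_(j < n | P j) dot (f j) (f j) =
  (\prod_(j < n | P j) rnorm (f j) ^+ 2)%:C.
Proof.
rewrite (rmorph_prod (real_complex R)).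
by apply: eq_bigr => j _; rewrite dot_rnorm.
Qed.

(** The elementary tensor of [f], described by all its inner products with
    elementary tensors.  Unlike [pure_tensor f g], this is the form needed to apply
    [isometric_extension] in the next coordinate. *)
Let represents f g := forall f' g', pure_tensor f' g' ->
  dot g g' = \prod_(i < n) dot (f i) (f' i).

Let represents_pure f g : represents f g -> pure_tensor f g.
Proof.
move=> fg z; rewrite -reproducing (fg _ _ (pure_tensor_kern z)).
by apply: eq_bigr => i _; rewrite reproducing.
Qed.

(** Elementary tensors of kernels are kernels.  Then one factor at a time is
    made arbitrary: with the others fixed, the tensor is a multiple of an isometry
    in that factor, defined on the kernels. *)
Let represents_exists f : exists g, represents f g.
Proof.
apply: (@coordinatewise _ _ (fun=> range (kern H1)) (fun=> setT)
  (fun f => exists g, represents f g) _ _ f) => //.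
- move=> i {}f fk h _.
  have /choice [e eP] : forall u, exists g, represents (update f i (kern H1 u)) g.
    by move=> u; apply: fk; exists u.
  have ed u v : dot (e u) (e v) =
      (\prod_(j < n | j != i) rnorm (f j) ^+ 2)%:C * dot (kern H1 u) (kern H1 v).
    rewrite (eP _ _ _ (represents_pure (eP v))) prod_update update_eq mulrC.
    congr (_ * _); rewrite -prod_dot_real; apply: eq_bigr => j ji.
    by rewrite update_neq.
  have [g gP] := isometric_extension (@kern_total _ _ _ H1) ed h.
  exists g => f' g' fg'; rewrite prod_update.
  set c := \prod_(j < n | _) _.
  rewrite (gP (Num.conj c *: f' i)); first by rewrite dotZr conjCK mulrC.
  by move=> u; rewrite (eP _ _ _ fg') prod_update -/c dotZr conjCK mulrC.
- move=> {}f fk; have /choice [u uE] : forall i, exists u, f i = kern H1 u.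
    by move=> i; have [u _ <-] := fk i; exists u.
  exists (kern H (fun i => u i ord0)) => f' g' fg'.
  rewrite dotC reproducing fg' rmorph_prod; apply: eq_bigr => i _ /=.
  rewrite uE [RHS]dotC reproducing; congr (Num.conj (ev _ _)).
  by apply: funext => j; rewrite (ord1 j).
Qed.

Definition tensor_vec f : H := xget 0 [set g | pure_tensor f g].

Lemma ev_tensor_vec f : pure_tensor f (tensor_vec f).
Proof.
have [g fg] := represents_exists f.
by rewrite /tensor_vec; case: xgetP => [//|/(_ g)/(_ (represents_pure fg))].
Qed.

Lemma pure_tensor_unique f g : pure_tensor f g -> g = tensor_vec f.
Proof. by move=> fg; apply: eq_ev => z; rewrite fg ev_tensor_vec. Qed.

Lemma dot_tensor_vec f f' :
  dot (tensor_vec f) (tensor_vec f') = \prod_(i < n) dot (f i) (f' i).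
Proof.
have [g fg] := represents_exists f.
rewrite -(pure_tensor_unique (represents_pure fg)); apply: fg.
exact: ev_tensor_vec.
Qed.

Lemma ev_tensor_vec_update f i h z :
  ev (tensor_vec (update f i h)) z =
  ev h (fun=> z i) * \prod_(j < n | j != i) ev (f j) (fun=> z j).
Proof.
rewrite ev_tensor_vec (bigD1 i) //= update_eq; congr (_ * _).
by apply: eq_bigr => j ji; rewrite update_neq.
Qed.

Lemma tensor_vec_update_linear f i (a : R[i]) h h' :
  tensor_vec (update f i (a *: h + h')) =
  a *: tensor_vec (update f i h) + tensor_vec (update f i h').
Proof.
apply: eq_ev => z; rewrite evD evZ !ev_tensor_vec_update.
by rewrite evD evZ mulrDl mulrA.
Qed.

Lemma tensor_vec_update_bounded f i : exists c : R, forall h,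
  rnorm (tensor_vec (update f i h)) <= c * rnorm h.
Proof.
exists (`|\prod_(j < n | j != i) rnorm (f j) ^+ 2| + 1) => h.
apply: rnorm_scaled; rewrite dot_tensor_vec prod_update update_eq mulrC.
congr (_ * _); rewrite -prod_dot_real; apply: eq_bigr => j ji.
by rewrite update_neq.
Qed.

Lemma tensor_vec0 f i : f i = 0 -> tensor_vec f = 0.
Proof.
by move=> fi; apply: dot_eq0; rewrite dot_tensor_vec (bigD1 i) //= fi dot0l mul0r.
Qed.

Theorem tensor_closed_span (D : 'I_n -> set H1) (A : set H) : closed_subspace A ->
  (forall f, (forall i, D i (f i)) -> A (tensor_vec f)) ->
  forall f, (forall i, closed_span (D i) (f i)) -> A (tensor_vec f).
Proof.
move=> Ac AD f; apply: (@coordinatewise _ _ D (fun i => closed_span (D i))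
  (fun f => A (tensor_vec f)) _ AD f) => i {}f fD h Dh.
have [c cP] := tensor_vec_update_bounded f i.
apply: (closed_span_sub (A := (fun h => tensor_vec (update f i h)) @^-1` A)) Dh => //.
by apply: closed_subspace_preimage Ac => // *; exact: tensor_vec_update_linear.
Qed.

Lemma Mz_pow_tensor_vec (k : 'I_n -> nat) f :
  Mz_pow k (tensor_vec f) = tensor_vec (fun i => iter (k i) (Mz ord0) (f i)).
Proof.
apply: eq_ev => z; rewrite ev_Mz_pow !ev_tensor_vec -big_split /=.
by apply: eq_bigr => i _; rewrite ev_iter_Mz.
Qed.

Lemma Mz_tensor_vec i f :
  Mz i (tensor_vec f) = tensor_vec (update f i (Mz ord0 (f i))).
Proof.
apply: eq_ev => z; rewrite ev_Mz -{1}(updateE f i) !ev_tensor_vec_update.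
by rewrite ev_Mz mulrA.
Qed.

Lemma tensor_vec_in (Q : 'I_n -> set H1) f : (forall i, Q i (f i)) ->
  tensor (H := H) Q (tensor_vec f).
Proof.
by move=> Qf; apply: sub_closed_span; exists f => // z; exact: ev_tensor_vec.
Qed.

End Tensors.

(** * The rank of a submodule *)

Section Rank.
Context {R : realType} {n : nat} {H : hardy R n}.
Implicit Types (S E : set H) (f g : H) (i j : 'I_n) (k : 'I_n -> nat).

Lemma Mz_pow0 f : Mz_pow (fun=> 0%N) f = f.
Proof.
by apply: eq_ev => z; rewrite ev_Mz_pow big1 ?mul1r // => i _; rewrite expr0.
Qed.

Lemma Mz_powS k j f : (0 < k j)%N ->
  Mz_pow k f = Mz j (Mz_pow (update k j (k j).-1) f).
Proof.
move=> kj; apply: eq_ev => z; rewrite ev_Mz !ev_Mz_pow mulrA; congr (_ * _).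
rewrite (bigD1 j) //= [in RHS](bigD1 j) //= update_eq mulrA -exprS prednK //.
by congr (_ * _); apply: eq_bigr => i ij; rewrite update_neq.
Qed.

Lemma submodule_Mz_pow S k f : submodule S -> S f -> S (Mz_pow k f).
Proof.
move=> [_ SM] Sf; rewrite /Mz_pow.
elim/big_rec: _ f Sf => [//|i T _ IH] f Sf /=.
by elim: (k i) => [|m] /=; [exact: IH | exact: SM].
Qed.

Lemma counting_range (T : choiceType) m (v : 'I_m -> T) :
  (counting (range v) <= m%:R%:E :> \bar R)%E.
Proof.
rewrite /counting asboolT; last by apply: finite_image; exact: finite_finset.
rewrite lee_fin ler_nat; apply: geq_card_fset_set.
apply: card_le_trans (card_image_le _ _) _.
by rewrite -(card_le_eql card_II).
Qed.

(** Let [F] be a combination of the [v l].  As the [v l] are orthogonal to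
    every [z_j S], only the inner products of [F] with the generators [E]
    themselves decide whether [F] is orthogonal to [S].  With fewer than [m]
    generators these are fewer than [m] linear equations in the [m] coefficients,
    so some nonzero [F] in [S] would be orthogonal to [S]. *)
Lemma rank_ge_orthogonal S m (v : 'I_m -> H) : submodule S ->
  (forall l, S (v l)) -> (forall l, v l != 0) ->
  (forall l l', l != l' -> dot (v l) (v l') = 0) ->
  (forall l j f, S f -> dot (Mz j f) (v l) = 0) ->
  (m%:R%:E <= rank S)%E.
Proof.
move=> Ssub Sv v0 vv vM; apply: le_ereal_inf_tmp => _ [E [ES SE] <-].
rewrite /counting; case: ifPn => [/asboolP Efin|_]; last exact: leey.
rewrite lee_fin ler_nat leqNgt; apply/negP => pm.
pose s : seq H := finmap.enum_fset (fset_set E).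
pose A : 'M[R[i]]_(m, size s) :=
  \matrix_(l, q) Num.conj (dot (tnth (in_tuple s) q) (v l)).
have kA : kermx A != 0.
  by rewrite -mxrank_eq0 mxrank_ker -lt0n subn_gt0 (leq_ltn_trans (rank_leq_col _)).
have /rowV0Pn [b /sub_kermxP bA b0] := kA.
pose F := \sum_(l < m) b 0 l *: v l.
have SF : S F.
  have [S0 SP] := (linear_subspaceP _).1 Ssub.1.2.
  rewrite /F; elim/big_ind: _ => // [f g Sf Sg|l _].
    by apply: subspaceD => //; exact: Ssub.1.2.
  by apply: subspaceZ => //; exact: Ssub.1.2.
have dotF g : dot F g = \sum_(l < m) b 0 l * dot (v l) g.
  rewrite /F; elim/big_ind2: _ => [|x y x' y' <- <-|l _]; first exact: dot0l.
    exact: dotDl.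
  exact: dotZl.
have FE e : E e -> dot F e = 0.
  move=> Ee; have es : e \in s by rewrite /s in_fset_set // inE.
  have /tnthP [q ->] : e \in in_tuple s by [].
  move/matrixP: bA => /(_ 0 q); rewrite !mxE => bA.
  rewrite dotF -[RHS]bA; apply: eq_bigr => l _; rewrite mxE.
  by congr (_ * _); exact: dotC.
have F0 : F = 0.
  apply: dot_eq0; move: (SF); rewrite -{1}SE => /orth_closed_span; apply.
  move=> _ [k _ [e Ee <-]]; have [k0|] := pselect (forall j, k j = 0%N).
    by rewrite (_ : k = fun=> 0%N) ?Mz_pow0 ?FE //; exact: funext.
  move=> /existsNP [j /eqP]; rewrite -lt0n => kj.
  rewrite (Mz_powS _ kj) dotF big1 // => l _.
  rewrite [dot (v l) _]dot_eq0C ?mulr0 // vM //.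
  exact: submodule_Mz_pow Ssub (ES _ Ee).
move/eqP: b0; apply; apply/rowP => l; rewrite mxE; apply/eqP.
have /eqP := dotF (v l); rewrite F0 dot0l eq_sym (bigD1 l) //= big1 ?addr0.
  by rewrite mulf_eq0 (gt_eqF (dot_gt0 (v0 l))) orbF.
by move=> l' l'l; rewrite vv ?mulr0.
Qed.

End Rank.

(** * Generators of the complement of a tensor product *)

Section CoDoublyCommuting.
Context {R : realType} {n : nat} {H1 : hardy R 1} {H : hardy R n}.
Context {Q : 'I_n -> set H1} {theta : 'I_n -> H1}.
Context (Q_closed : forall i, closed_subspace (Q i)).
Context (theta_wandering :
  forall i g, orthogonal_compl (Q i) g -> dot (Mz ord0 g) (theta i) = 0).
Context (theta_generates : forall i,
  orthogonal_compl (Q i) = closed_span [set iter m (Mz ord0) (theta i) | m in setT]).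
Implicit Types (i j : 'I_n) (f : 'I_n -> H1) (F : H) (k : 'I_n -> nat).

Local Notation S := (orthogonal_compl (tensor (H := H) Q)).
Local Notation Theta i := (tensor_vec (H := H) (update (fun=> one) i (theta i))).

Lemma compl_iter_theta i m : orthogonal_compl (Q i) (iter m (Mz ord0) (theta i)).
Proof. by rewrite theta_generates; apply: sub_closed_span; exists m. Qed.

Lemma theta_in_compl i : orthogonal_compl (Q i) (theta i).
Proof. exact: (@compl_iter_theta i 0%N). Qed.

Lemma theta_eq0 i : (theta i == 0) = (Q i == setT).
Proof.
apply/eqP/eqP => [t0|QT]; last by apply: dot_eq0; apply: theta_in_compl; rewrite QT.
rewrite -(orthogonal_complK (Q_closed i)) eqEsubset; split=> // g _ h.
rewrite theta_generates t0 => hL.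
suff -> : h = 0 by rewrite dot0r.
apply: (closed_span_sub (A := [set 0]) _ _ hL).
  rewrite [X in closed_subspace X](_ : _ = orthogonal_compl (@setT H1)).
    exact: orthogonal_compl_closed.
  rewrite eqEsubset; split=> [_ -> x _|x xT]; first exact: dot0l.
  by apply: dot_eq0; exact: xT.
move=> _ [m _ <-] /=; apply: eq_ev => z.
by rewrite ev_iter_Mz ev0 mulr0.
Qed.

Lemma generators_in i : S (Theta i).
Proof.
apply: orth_closed_span => g [f Qf fg].
rewrite (pure_tensor_unique fg) dot_tensor_vec (bigD1 i) //= update_eq.
by rewrite (theta_in_compl (Qf i)) mul0r.
Qed.

(** The shifts of [theta_i(z_i)] are the elementary tensors of shifts of
    [theta_i] with monomials in the other variables, so they span all elementary
    tensors whose [i]-th factor lies in the complement of [Q i]. *)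
Lemma orth_generators_tensor F i f :
  (forall k, dot (Mz_pow k (Theta i)) F = 0) -> orthogonal_compl (Q i) (f i) ->
  dot (tensor_vec f) F = 0.
Proof.
move=> FT fi.
pose D j := [set iter m (Mz ord0) (update (fun=> one) i (theta i) j) | m in setT].
apply: (@tensor_closed_span _ _ _ _ D (orthogonal_compl [set F])) => //.
- exact: orthogonal_compl_closed.
- move=> d dD _ ->; have /choice [k kE] : forall j, exists m,
      iter m (Mz ord0) (update (fun=> one) i (theta i) j) = d j.
    by move=> j; have [m _ <-] := dD j; exists m.
  by rewrite -(FT k) Mz_pow_tensor_vec; congr (dot (tensor_vec _) _); exact/funext.
- move=> j; have [->|ji] := eqVneq j i.
    by rewrite /D update_eq -theta_generates.
  rewrite /D update_neq // total_closed_span // => g gM.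
  by apply: monomials_total => m; apply: gM; exists m.
Qed.

(** Splitting a vector into its components in [Q i] and in the complement of
    [Q i], one factor at a time, reduces elementary tensors to those in [tensor Q]
    and those treated by [orth_generators_tensor]; both are orthogonal to [F]. *)
Lemma generators_total F : S F ->
  (forall i k, dot (Mz_pow k (Theta i)) F = 0) -> F = 0.
Proof.
move=> SF FT; have FQ f : dot (tensor_vec f) F = 0.
  apply: (@coordinatewise _ _ Q (fun=> setT)
    (fun f => dot (tensor_vec f) F = 0) _ _ f) => //.
    move=> i {}f fQ h _; have [q Qq hq] := projection h (Q_closed i).
    have -> : h = 1 *: q + (h - q) by rewrite scale1r addrC subrK.
    rewrite tensor_vec_update_linear dotDl dotZl fQ // mulr0 add0r.
    by apply: (orth_generators_tensor (i := i)) => //; rewrite update_eq.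
  by move=> {}f fQ; apply: dot_eq0C; apply: SF; exact: tensor_vec_in.
apply: kern_total => w; apply: dot_eq0C.
by rewrite (pure_tensor_unique (pure_tensor_kern (H1 := H1) w)).
Qed.

Lemma generates_Theta m (sigma : 'I_m -> 'I_n) : submodule S ->
  (forall i, Q i != setT -> exists l, sigma l = i) ->
  generates (range (fun l => Theta (sigma l))) S.
Proof.
move=> Ssub sigmaP; split; first by move=> _ [l _ <-]; exact: generators_in.
apply: closed_subspace_eq Ssub.1.2 _ _; first exact: closed_span_closed.
  apply: closed_span_sub Ssub.1 _ => _ [k _ [_ [l _ <-] <-]].
  exact: submodule_Mz_pow Ssub (@generators_in _).
move=> F SF FE; apply: generators_total => // i k.
have [QT|/sigmaP [l <-]] := eqVneq (Q i) setT.
  have /eqP t0 : theta i == 0 by rewrite theta_eq0 QT.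
  rewrite Mz_pow_tensor_vec (tensor_vec0 (i := i)) ?dot0l // update_eq t0.
  by apply: eq_ev => z; rewrite ev_iter_Mz ev0 mulr0.
apply: dot_eq0C; apply: FE; apply: sub_closed_span.
by exists k => //; exists (Theta (sigma l)) => //; exists l.
Qed.

Context (one_in : forall i, Q i one).

Lemma dot_iter_theta_one i m : dot (iter m (Mz ord0) (theta i)) one = 0.
Proof. exact: compl_iter_theta. Qed.

Lemma Theta_orthogonal i j : i != j -> dot (Theta i) (Theta j) = 0.
Proof.
move=> ij; rewrite dot_tensor_vec (bigD1 i) //= update_eq update_neq //.
by rewrite (dot_iter_theta_one i 0%N) mul0r.
Qed.

Lemma Theta_neq0 i : Q i != setT -> Theta i != 0.
Proof.
rewrite -theta_eq0 => t0; apply/eqP => T0; have /eqP := dot_tensor_vec (H := H)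
  (update (fun=> one) i (theta i)) (update (fun=> one) i (theta i)).
rewrite T0 dot0l eq_sym; apply/negP/prodf_neq0 => j _.
have [->|ji] := eqVneq j i; first by rewrite update_eq gt_eqF // dot_gt0.
by rewrite update_neq // dot_one ev_one oner_eq0.
Qed.

(** Compare [z_j z^k theta_l(z_l)] with [theta_i(z_i)] factor by factor.  If
    [l <> i], the [l]-th factors are a multiple of [theta_l] and the constant 1; if
    [l = i = j], the [i]-th ones are a proper shift of [theta_i] and [theta_i];
    if [l = i <> j], the [j]-th ones are a nonconstant monomial and 1.  In each
    case these factors are orthogonal. *)
Lemma Theta_wandering i j F : submodule S -> S F -> dot (Mz j F) (Theta i) = 0.
Proof.
move=> Ssub SF.
have [_ SE] := generates_Theta (sigma := id) Ssub (fun i _ => ex_intro _ i erefl).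
suff : ((Mz j : H -> H) @^-1` orthogonal_compl [set Theta i]) F by exact.
move: SF; rewrite -{1}SE; apply: closed_span_sub.
  apply: (closed_subspace_preimage (c := 1)); first exact: Mz_linear.
    by move=> h; rewrite mul1r rnorm_Mz.
  exact: orthogonal_compl_closed.
move=> _ [k _ [_ [l _ <-] <-]] _ -> /=.
rewrite Mz_pow_tensor_vec Mz_tensor_vec dot_tensor_vec.
have [->|li] := eqVneq l i; last first.
  rewrite (bigD1 l) //= [update _ i _ l]update_neq //.
  have [lj|lj] := eqVneq l j; last first.
    by rewrite update_neq // update_eq dot_iter_theta_one mul0r.
  by rewrite lj update_eq -lj update_eq -iterS dot_iter_theta_one mul0r.
rewrite (bigD1 j) //= update_eq; have [->|ji] := eqVneq j i.
  by rewrite update_eq theta_wandering ?mul0r //; exact: compl_iter_theta.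
by rewrite !update_neq // dot_one ev_Mz /= !mul0r.
Qed.

End CoDoublyCommuting.

Theorem theorem6p2 (R : realType) (n : nat) (hn : (2 <= n)%N)
    (H1 : hardy R 1) (H : hardy R n) (Q : 'I_n -> set H1)
    (hQ : forall i, quotient_module (Q i))
    (S : set H) (hS : S = orthogonal_compl (tensor Q))
    (hcdc : co_doubly_commuting S) :
  (rank S <= (#|[pred i : 'I_n | Q i != setT]|)%:R%:E)%E /\
  ((forall i, exists2 f, Q i f & forall z, ev f z = 1) ->
   rank S = (#|[pred i : 'I_n | Q i != setT]|)%:R%:E).
Proof.
have [Ssub _] := hcdc; rewrite hS in Ssub *.
have Qc i : closed_subspace (Q i) := (hQ i).1.
have /choice [theta thetaP] := fun i => Beurling (hQ i).2.
have tW i g : orthogonal_compl (Q i) g -> dot (Mz ord0 g) (theta i) = 0.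
  by have [_ + _] := thetaP i; apply.
have tG i : orthogonal_compl (Q i) =
    closed_span [set iter m (Mz ord0) (theta i) | m in setT].
  by have [] := thetaP i.
set P := [pred i | _]; pose sigma (l : 'I_#|P|) := enum_val l.
pose v l := tensor_vec (H := H) (update (fun=> one) (sigma l) (theta (sigma l))).
have le_rank : (rank (orthogonal_compl (tensor (H := H) Q)) <= #|P|%:R%:E)%E.
  apply: ge_ereal_inf; exists (counting (range v)); last exact: counting_range.
  exists (range v) => //; apply: (generates_Theta Qc tG (sigma := sigma)) => // i Qi.
  have Pi : i \in P by rewrite inE.
  by exists (enum_rank_in Pi i); rewrite /sigma enum_rankK_in.
split=> // Q1; apply/eqP; rewrite eq_le le_rank /=.
have Qone i : Q i one.
  have [f Qf f1] := Q1 i; rewrite (_ : one = f) //.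
  by apply: eq_ev => z; rewrite ev_one f1.
apply: (rank_ge_orthogonal (v := v)) => //.
- by move=> l; exact: generators_in tG _.
- by move=> l; apply: (Theta_neq0 Qc tG); have := enum_valP l; rewrite inE.
- move=> l l' ll'; apply: (Theta_orthogonal tG Qone).
  by rewrite (inj_eq enum_val_inj).
- by move=> l j f Sf; exact: (Theta_wandering Qc tW tG Qone).
Qed.
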